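(* Let $F$ be a finite simple graph and let $G$ be a $k$-fold cover of $F$. Then (a) if $F$ is $3$-regular, $\gamma_t(G) \geq \frac{3}{5}\,k\,\gamma_t(F)$; (b) if $F$ is $4$-regular or $5$-regular, $\gamma_t(G) \geq \frac{1}{2}\,k\,\gamma_t(F)$.
   Context: All graphs are finite, simple and undirected. A graph $G$ is a cover of a graph $F$ if there is an onto map $\pi: V(G)\to V(F)$ such that for every vertex $v$ of $G$, $\pi$ maps the neighbours of $v$ in $G$ bijectively onto the neighbours of $\pi(v)$ in $F$; the cover is $k$-fold if every fibre $\pi^{-1}(u)$ has exactly $k$ vertices. A total dominating set of a graph is a set $S$ of vertices such that every vertex of the graph is adjacent to some vertex of $S$; $\gamma_t(\cdot)$ denotes the total domination number, the minimum size of a total dominating set. *)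

(* Defs.v *)
From mathcomp Require Import all_boot all_order all_algebra.
Set Implicit Arguments. Unset Strict Implicit. Unset Printing Implicit Defensive.

Definition simple_graph (V : finType) (adj : rel V) : Prop :=
  symmetric adj /\ irreflexive adj.

Definition nbhd (V : finType) (adj : rel V) (v : V) : {set V} :=
  [set u | adj v u].

Definition regular (V : finType) (adj : rel V) (d : nat) : Prop :=
  forall v : V, #|nbhd adj v| = d.

Definition is_cover (VG VF : finType) (adjG : rel VG) (adjF : rel VF)
    (pi : VG -> VF) : Prop :=
  (forall u : VF, exists v : VG, pi v = u) /\
  (forall v : VG, {in nbhd adjG v &, injective pi} /\
                  pi @: nbhd adjG v = nbhd adjF (pi v)).

Definition k_fold_cover (VG VF : finType) (adjG : rel VG) (adjF : rel VF)
    (pi : VG -> VF) (k : nat) : Prop :=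
  is_cover adjG adjF pi /\ (forall u : VF, #|pi @^-1: [set u]| = k).

Definition total_dominating (V : finType) (adj : rel V) (S : {set V}) : bool :=
  [forall v : V, [exists s in S, adj v s]].

(* total domination number: minimum size of a total dominating set
   (default #|V| if none exists; irrelevant for the graphs considered) *)
Definition gamma_t (V : finType) (adj : rel V) : nat :=
  \big[minn/#|V|]_(S : {set V} | total_dominating adj S) #|S|.

(* Main.v *)
Require Import Defs.
From mathcomp Require Import all_boot all_order all_algebra.
From mathcomp Require Import zify lra.
Import Order.TTheory GRing.Theory Num.Theory.

Set Implicit Arguments. Unset Strict Implicit. Unset Printing Implicit Defensive.

(** A total dominating set of an [r]-regular graph on [n] vertices has at least
    [n/r] vertices, so [gamma_t G >= k |F| / r], and it suffices to show
    [gamma_t F <= 5n/9], [n/2], [2n/5] for [r = 3, 4, 5].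

    Build a total dominating set greedily, always adding a vertex with the most
    undominated neighbours. Once no vertex has more than [d] of them, double
    counting bounds the number [u] of undominated vertices by
    [r u <= d (n - |S|)], because the vertices of [S] have none. These linear
    inequalities give the bounds for [r = 3, 4], but only [0.4116 n] for
    [r = 5]. There, the phase [d = 2] is a matching problem in the multigraph
    whose vertices are the undominated vertices [U] and whose edges are the
    vertices with two neighbours in [U]; a matching without augmenting paths of
    length 3, instead of a merely maximal one, brings the total below
    [2n/5]. *)

(** * Counting in regular graphs and their covers *)

Lemma gamma_t_le (V : finType) (adj : rel V) (S : {set V}) :
  total_dominating adj S -> gamma_t adj <= #|S|.
Proof.
move=> domS; rewrite /gamma_t.
have : S \in index_enum {set V} by rewrite mem_index_enum.
elim: (index_enum _) => [//|T s IHs]; rewrite inE big_cons.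
case/orP=> [/eqP <-|/IHs leS]; first by rewrite domS geq_minl.
by case: ifP => // _; apply: leq_trans leS; rewrite geq_minr.
Qed.

Lemma sum_card_nbhdI (V : finType) (adj : rel V) (U : {set V}) :
  symmetric adj ->
  \sum_w #|nbhd adj w :&: U| = \sum_(u in U) #|nbhd adj u|.
Proof.
move=> symA.
transitivity (\sum_w \sum_(u in U) (adj u w : nat)).
  apply: eq_bigr => w _; rewrite -sum1dep_card big_mkcond [RHS]big_mkcond /=.
  by apply: eq_bigr => u _; rewrite !inE symA; case: (adj u w); case: (u \in U).
rewrite exchange_big /=; apply: eq_bigr => u _.
rewrite -sum1dep_card [RHS]big_mkcond /=.
by apply: eq_bigr => w _; case: (adj u w).
Qed.

Lemma gamma_t_ge_regular (V : finType) (adj : rel V) (r : nat) :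
  symmetric adj -> regular adj r -> 0 < r -> #|V| <= r * gamma_t adj.
Proof.
move=> symA regA r_gt0; rewrite /gamma_t.
elim/big_ind: _ => [|x y lex ley|S /forallP domS].
(* The default value [#|V|] of the minimum obeys the bound too, since [0 < r]. *)
- by rewrite leq_pmull.
- by rewrite /minn; case: ifP.
have -> : r * #|S| = \sum_(s in S) #|nbhd adj s|.
  by under eq_bigr => s _ do rewrite regA; rewrite sum_nat_const mulnC.
rewrite -sum_card_nbhdI // -sum1_card; apply: leq_sum => v _.
have /existsP[s /andP[sS vs]] := domS v.
by rewrite card_gt0; apply/set0Pn; exists s; rewrite !inE vs.
Qed.

Lemma card_k_fold_cover (VG VF : finType) (adjG : rel VG) (adjF : rel VF) pi k :
  k_fold_cover adjG adjF pi k -> #|VG| = k * #|VF|.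
Proof.
case=> _ fibre; rewrite -sum1_card (partition_big pi predT) //=.
under eq_bigr => u _.
  rewrite (_ : \sum_(i | _) 1 = k); last first.
    rewrite -(fibre u) -sum1_card; apply: eq_bigl => v.
    by rewrite !inE.
  over.
by rewrite sum_nat_const mulnC.
Qed.

Lemma regular_cover (VG VF : finType) (adjG : rel VG) (adjF : rel VF) pi r :
  is_cover adjG adjF pi -> regular adjF r -> regular adjG r.
Proof.
case=> _ loc regF v; have [inj im] := loc v.
by rewrite -(regF (pi v)) -im card_in_imset.
Qed.

(** * Greedy domination *)

Definition undominated (V : finType) (adj : rel V) (S : {set V}) : {set V} :=
  [set v | [forall s in S, ~~ adj v s]].

Definition residual_degree (V : finType) (adj : rel V) (S : {set V}) (w : V) :=
  #|nbhd adj w :&: undominated adj S|.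

Section Greedy.

Context (V : finType) (adj : rel V) (r : nat).
Hypothesis symA : symmetric adj.
Hypothesis regA : regular adj r.

Local Notation U := (undominated adj).
Local Notation deg := (residual_degree adj).

Lemma undominatedP (S : {set V}) v :
  reflect (forall s, s \in S -> ~~ adj v s) (v \in U S).
Proof. by rewrite inE; apply: (iffP forall_inP). Qed.

Lemma undominatedU1 (S : {set V}) w : U (w |: S) = U S :\: nbhd adj w.
Proof.
apply/setP=> v; rewrite in_setD [v \in nbhd _ _]inE.
apply/undominatedP/andP => [H|[vw /undominatedP H] s].
  rewrite symA H ?setU11 //; split=> //; apply/undominatedP => s sS.
  by rewrite H // setU1r.
by case/setU1P=> [->|/H //]; rewrite symA.
Qed.

Lemma card_undominatedU1 (S : {set V}) w : #|U (w |: S)| + deg S w = #|U S|.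
Proof.
by rewrite undominatedU1 /residual_degree [_ :&: _]setIC addnC cardsID.
Qed.

Lemma residual_degree_in (S : {set V}) w : w \in S -> deg S w = 0.
Proof.
move=> wS; apply/eqP; rewrite cards_eq0; apply/set0Pn => -[v].
rewrite inE [v \in nbhd _ _]inE => /andP[wv /undominatedP/(_ _ wS)].
by rewrite symA wv.
Qed.

Lemma sum_residual_degree (S : {set V}) :
  \sum_(w in ~: S) deg S w = r * #|U S|.
Proof.
have -> : r * #|U S| = \sum_w deg S w.
  rewrite sum_card_nbhdI //; under eq_bigr => u _ do rewrite regA.
  by rewrite sum_nat_const mulnC.
rewrite [RHS](bigID (mem S)) /= [X in X + _]big1 ?add0n => [|w].
  by apply: eq_bigl => w; rewrite inE.
exact: residual_degree_in.
Qed.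

Lemma undominated_le (S : {set V}) d :
  (forall w, deg S w <= d) -> r * #|U S| <= d * (#|V| - #|S|).
Proof.
move=> degS; rewrite -sum_residual_degree.
have -> : #|V| - #|S| = #|~: S| by rewrite -(cardsC S) addKn.
by rewrite mulnC -sum_nat_const; apply: leq_sum.
Qed.

(** As long as some vertex has [d.+1] undominated neighbours, the largest number allowed, add it.
    Each addition dominates exactly [d.+1] new vertices, so [x] additions are accounted for by an
    equality. *)
Lemma greedy_phase (S : {set V}) d :
  (forall w, deg S w <= d.+1) ->
  exists T : {set V}, exists x,
    [/\ #|T| = #|S| + x, #|U S| = #|U T| + d.+1 * x,
        forall w, deg T w <= d & r * #|U T| <= d * (#|V| - #|T|)].
Proof.
move: {2}#|U S|.+1 (ltnSn #|U S|) => n; elim: n S => // n IHn S leUn degS.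
have [/existsP[w /eqP degw]|] := boolP [exists w, deg S w == d.+1]; last first.
  rewrite negb_exists => /forallP ndeg.
  have degSd w : deg S w <= d.
    move: (ndeg w) (degS w).
    by rewrite [deg S w <= d.+1]leq_eqVlt ltnS => /negPf->.
  by exists S, 0; rewrite addn0 muln0 addn0; split=> //; apply: undominated_le.
have UwS := card_undominatedU1 S w.
have wS : w \notin S by apply: contraTN (ltn0Sn d) => /residual_degree_in; lia.
have [||T [x [cT cU degT leT]]] := IHn (w |: S).
- by lia.
- move=> v; apply: leq_trans (degS v); apply: subset_leq_card.
  by apply: setIS; rewrite undominatedU1 subsetDl.
exists T, x.+1; split=> //; first by rewrite cT cardsU1 wS; lia.
by rewrite mulnS; lia.
Qed.

Lemma gamma_t_le_undominated0 (S : {set V}) : #|U S| = 0 -> gamma_t adj <= #|S|.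
Proof.
move/eqP; rewrite cards_eq0 => /eqP US; apply: gamma_t_le; apply/forallP=> v.
apply: contraT; rewrite negb_exists => /forallP H.
suff : v \in U S by rewrite US inE.
by apply/undominatedP => s sS; have := H s; rewrite sS.
Qed.

Lemma residual_degree_le (S : {set V}) w : deg S w <= r.
Proof. by rewrite -(regA w) subset_leq_card // subsetIl. Qed.

Lemma undominated_set0 : #|U set0| = #|V|.
Proof.
rewrite -cardsT; congr #|pred_of_set _|; apply/setP=> v; rewrite !inE.
by apply/forall_inP => s; rewrite inE.
Qed.

(** * Augmentations and the matching phase *)

Lemma card_swap (T : {set V}) a x y :
  a \in T -> #|x |: (y |: (T :\ a))| <= #|T|.+1.
Proof.
move=> aT; rewrite !cardsU1 (cardsD1 a T) aT.
by do 2 case: (_ \notin _); lia.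
Qed.

(** When all residual degrees of [S] are at most 2, the inequality forces each vertex of [T' :\: S]
    to dominate exactly two new vertices, disjointly from the others: these vertices form a
    matching. Minimality then means that no matching covers more of [U S] than [T] does. *)
Definition undominated_minimal (S T : {set V}) :=
  forall T' : {set V}, S \subset T' ->
    #|U T'| + 2 * #|T'| <= #|U S| + 2 * #|S| -> #|U T| <= #|U T'|.

(* Otherwise replacing [a] by [z1] and [z2] is an augmentation: [T] would grow by
   at most one vertex and dominate both [w1] and [w2] in addition. *)
Lemma undominated_exchange (S T : {set V}) a z1 z2 w1 w2 :
  S \subset T -> #|U T| + 2 * #|T| <= #|U S| + 2 * #|S| ->
  undominated_minimal S T ->
  a \in T :\: S -> nbhd adj a :&: U S \subset nbhd adj z1 :|: nbhd adj z2 ->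
  w1 \in U T -> w2 \in U T -> adj z1 w1 -> adj z2 w2 -> w1 = w2.
Proof.
move=> sST leT minT /setDP[aT aS] sub w1T w2T z1w1 z2w2.
apply/eqP/negPn/negP => ne.
pose T' := z1 |: (z2 |: (T :\ a)).
have sST' : S \subset T'.
  apply/subsetP => s sS; rewrite !inE (subsetP sST) // andbT.
  by rewrite (contraNneq _ aS) ?orbT // => <-.
have sU : U T' \subset U T :\: [set w1; w2].
  apply/subsetP => v /undominatedP vT'.
  have vz1 : ~~ adj v z1 by apply: vT'; rewrite !inE eqxx.
  have vz2 : ~~ adj v z2 by apply: vT'; rewrite !inE eqxx orbT.
  rewrite inE !inE negb_or.
  rewrite (contraNneq _ vz1) => [|->]; last by rewrite symA.
  rewrite (contraNneq _ vz2) => [|->]; last by rewrite symA.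
  apply/forall_inP => s sT; have [->|sa] := eqVneq s a; last first.
    by apply: vT'; rewrite !inE sa sT !orbT.
  (* Losing [a] does no harm: its neighbours in [U S] are dominated by [z1] or [z2], its other
     neighbours by [S]. *)
  apply/negP => va; have : v \in nbhd adj a :&: U S.
    rewrite inE [v \in nbhd _ _]inE symA va /=.
    by apply/undominatedP => t tS; apply/vT'/(subsetP sST').
  by move/(subsetP sub); rewrite !inE !(symA _ v) (negPf vz1) (negPf vz2).
have sW : [set w1; w2] \subset U T by rewrite subUset !sub1set w1T w2T.
have := subset_leq_card sU; rewrite cardsD (setIidPr sW).
have := subset_leq_card sW; rewrite cards2 ne => UT2 leU.
have leT' : #|T'| <= #|T|.+1 by apply: card_swap.
have : #|U T'| + 2 * #|T'| <= #|U S| + 2 * #|S| by lia.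
by move/(minT T' sST'); lia.
Qed.

(** The counted vertices are edges joining an end of [a] to an uncovered vertex. If they do not all
    meet at one end of [a], then two of them leave from different ends, and the exchange lemma
    forces all of them to reach the same uncovered vertex. In each case they lie in one
    neighbourhood, of size [r]. *)
Lemma card_rivals (S T : {set V}) a :
  S \subset T -> #|U T| + 2 * #|T| <= #|U S| + 2 * #|S| ->
  undominated_minimal S T -> a \in T :\: S -> deg S a <= 2 ->
  #|[set z | (0 < deg T z) && [exists p in nbhd adj a :&: U S, adj z p]]| <= r.
Proof.
move=> sST leT minT aTS dega; set Z := [set z | _].
have exch := undominated_exchange sST leT minT aTS.
have nbr z : z \in Z -> exists2 w, w \in U T & adj z w.
  rewrite inE => /andP[+ _]; rewrite card_gt0 => /set0Pn[w].
  by rewrite inE [w \in nbhd _ _]inE => /andP[]; exists w.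
have subr v : Z \subset nbhd adj v -> #|Z| <= r.
  by move/subset_leq_card; rewrite regA.
(* If [a] has a single neighbour in [U S], then [p = q]. *)
have [p [q A_pq]] : exists p q, nbhd adj a :&: U S = [set p; q]
    \/ Z = set0.
  case: (set_0Vmem (nbhd adj a :&: U S)) => [A0|[p pA]].
    exists a, a; right; apply/setP => z; rewrite inE [RHS]inE.
    by apply/negP => /andP[_ /existsP[p]]; rewrite A0 inE.
  move: dega; rewrite /residual_degree (cardsD1 p) pA ltnS => leA.
  case: (set_0Vmem ((nbhd adj a :&: U S) :\ p)) => [A0|[q qA]].
    by exists p, p; left; rewrite -(setD1K pA) A0 setU0 setUid.
  exists p, q; left; rewrite -(setD1K pA); congr (_ |: _).
  by apply/esym/eqP; rewrite eqEcard sub1set qA cards1.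
case: A_pq => [A_pq|->]; last by rewrite cards0.
have Zpq z : z \in Z -> adj z p || adj z q.
  rewrite inE A_pq => /andP[_ /existsP[t]]; rewrite !inE.
  by case/andP => /orP[]/eqP-> -> //; rewrite orbT.
have [/subr//|/subsetPn[z2 z2Z z2p]] := boolP (Z \subset nbhd adj p).
have [/subr//|/subsetPn[z1 z1Z z1q]] := boolP (Z \subset nbhd adj q).
have z1p : adj z1 p.
  by move: (Zpq _ z1Z) z1q; rewrite !inE symA [adj q _]symA => /orP[] // ->.
have z2q : adj z2 q.
  by move: (Zpq _ z2Z) z2p; rewrite !inE symA [adj p _]symA => /orP[] // ->.
have sub x y : adj x p -> adj y q ->
    nbhd adj a :&: U S \subset nbhd adj x :|: nbhd adj y.
  move=> xp yq; rewrite A_pq; apply/subsetP => t; rewrite !inE.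
  by case/orP => /eqP->; rewrite ?xp ?yq ?orbT.
have [w1 w1T z1w1] := nbr _ z1Z; have [w2 w2T z2w2] := nbr _ z2Z.
have w12 : w1 = w2 by apply: (exch _ _ _ _ (sub _ _ z1p z2q)).
apply: (subr w1); apply/subsetP => z zZ; have [w wT zw] := nbr _ zZ.
rewrite inE symA; case/orP: (Zpq _ zZ) => [zp|zq].
  by rewrite w12 -(exch _ _ _ _ (sub _ _ zp z2q) wT w2T zw z2w2).
by rewrite (exch _ _ _ _ (sub _ _ z1p zq) w1T wT z1w1 zw).
Qed.

(** For the last bound, sum [deg T z + deg S z] over the [z] outside [S]. A summand exceeds 2 only
    if it is 3; then [z] is an edge with one uncovered end and one end covered by some [a] of the
    matching. Each [a] accounts for at most [r] such [z]. *)
Lemma matching_phase (S : {set V}) :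
  (forall w, deg S w <= 2) ->
  exists T : {set V},
    [/\ #|S| <= #|T|, #|U T| + 2 * #|T| <= #|U S| + 2 * #|S|,
        forall w, deg T w <= 1 &
        r * (#|U T| + #|U S|) <= 2 * (#|V| - #|S|) + r * (#|T| - #|S|)].
Proof.
move=> degS.
pose ok (T : {set V}) :=
  (S \subset T) && (#|U T| + 2 * #|T| <= #|U S| + 2 * #|S|).
have okS : ok S by rewrite /ok subxx leqnn.
case: (arg_minnP (fun T => #|U T|) okS) => T /andP[sST leT] minT'.
have minT : undominated_minimal S T.
  by move=> T' sST' leT'; apply: minT'; rewrite /ok sST'.
(* Adding a vertex with two undominated neighbours would respect the constraint and contradict
   minimality. *)
have degT w : deg T w <= 1.
  rewrite leqNgt; apply/negP => deg2; have UwT := card_undominatedU1 T w.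
  have cT : #|w |: T| <= #|T|.+1 by rewrite cardsU1; case: (_ \notin _).
  have := minT (w |: T) (subset_trans sST (subsetUr _ _)).
  have -> : #|U (w |: T)| + 2 * #|w |: T| <= #|U S| + 2 * #|S| by lia.
  by move/(_ isT); lia.
exists T; split=> //; first exact: subset_leq_card.
pose Z a := [set z | (0 < deg T z) && [exists p in nbhd adj a :&: U S, adj z p]].
have pointwise z : deg T z + deg S z <= 2 + \sum_(a in T :\: S) (z \in Z a).
  have [|dS] := leqP (deg S z) 1; first by have := degT z; lia.
  have [|dT] := leqP (deg T z) 0; first by have := degS z; lia.
  suff : 0 < \sum_(a in T :\: S) (z \in Z a).
    by have := degT z; have := degS z; lia.
  have /subsetPn[p] : ~~ (nbhd adj z :&: U S \subset nbhd adj z :&: U T).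
    apply/negP => /subset_leq_card; have := degT z.
    by rewrite /residual_degree in dS *; lia.
  rewrite !in_setI => /andP[zp pS]; rewrite zp /= [p \in U T]inE.
  case/forall_inPn => a aT /negPn pa.
  have aS : a \notin S by apply: contraL pa => /(undominatedP _ _ pS).
  rewrite (bigD1 a) /=; last by rewrite inE aS.
  have -> // : z \in Z a.
  rewrite inE dT; apply/existsP; exists p; rewrite inE pS andbT.
  by move: zp; rewrite !inE (symA a) pa.
have cS : #|V| - #|S| = #|~: S| by rewrite -(cardsC S) addKn.
rewrite mulnDr -!sum_residual_degree cS.
apply: (@leq_trans (\sum_(z in ~: S) (deg T z + deg S z))).
  rewrite big_split leq_add2r /= big_mkcond [leqRHS]big_mkcond /=.
  apply: leq_sum => z _; rewrite !inE; case zT: (z \in T) => //=.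
  by rewrite (contraFN (subsetP sST z) zT).
apply: (@leq_trans (\sum_(z in ~: S) (2 + \sum_(a in T :\: S) (z \in Z a)))).
  by apply: leq_sum.
rewrite big_split /= sum_nat_const mulnC leq_add2l.
have -> : #|T| - #|S| = #|T :\: S| by rewrite cardsD (setIidPr sST).
rewrite exchange_big mulnC -sum_nat_const /=; apply: leq_sum => a aTS.
apply: leq_trans (card_rivals sST leT minT aTS (degS a)).
rewrite -/(Z a) -sum1_card big_mkcond [leqRHS]big_mkcond /=.
by apply: leq_sum => z _; case: (z \in Z a); case: (z \in ~: S).
Qed.

End Greedy.

(** * Upper bounds for degrees 3, 4 and 5 *)

Lemma gamma_t_3regular (V : finType) (adj : rel V) :
  symmetric adj -> regular adj 3 -> 9 * gamma_t adj <= 5 * #|V|.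
Proof.
move=> symA regA; have U0 := undominated_set0 adj.
have [|T3 [x3 [c3 u3 d3 l3]]] := greedy_phase symA regA (S := set0) (d := 2).
  exact: residual_degree_le.
have [T2 [x2 [c2 u2 d2 l2]]] := greedy_phase symA regA d3.
have [T1 [x1 [c1 u1 d1 l1]]] := greedy_phase symA regA d2.
(* The last phase has [d = 0], so [l1] bounds the undominated set by zero. *)
have /(@gamma_t_le_undominated0 _ _ _) : #|undominated adj T1| = 0 by lia.
by have := max_card T1; rewrite cards0 in c3; lia.
Qed.

Lemma gamma_t_4regular (V : finType) (adj : rel V) :
  symmetric adj -> regular adj 4 -> 2 * gamma_t adj <= #|V|.
Proof.
move=> symA regA; have U0 := undominated_set0 adj.
have [|T4 [x4 [c4 u4 d4 l4]]] := greedy_phase symA regA (S := set0) (d := 3).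
  exact: residual_degree_le.
have [T3 [x3 [c3 u3 d3 l3]]] := greedy_phase symA regA d4.
have [T2 [x2 [c2 u2 d2 l2]]] := greedy_phase symA regA d3.
have [T1 [x1 [c1 u1 d1 l1]]] := greedy_phase symA regA d2.
have /(@gamma_t_le_undominated0 _ _ _) : #|undominated adj T1| = 0 by lia.
by have := max_card T1; rewrite cards0 in c4; lia.
Qed.

(** With [n = #|V|] and [u2], [u3] the numbers of vertices undominated by [T2], [T3], the matching
    phase yields [15 * u2 + 5 * u3 <= 4 * (n - #|T3|)], by eliminating [#|T2| - #|T3|] from its two
    inequalities. *)
Lemma gamma_t_5regular (V : finType) (adj : rel V) :
  symmetric adj -> regular adj 5 -> 5 * gamma_t adj <= 2 * #|V|.
Proof.
move=> symA regA; have U0 := undominated_set0 adj.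
have [|T5 [x5 [c5 u5 d5 l5]]] := greedy_phase symA regA (S := set0) (d := 4).
  exact: residual_degree_le.
have [T4 [x4 [c4 u4 d4 l4]]] := greedy_phase symA regA d5.
have [T3 [x3 [c3 u3 d3 l3]]] := greedy_phase symA regA d4.
have [T2 [c2 u2 d2 l2]] := matching_phase symA regA d3.
have [T1 [x1 [c1 u1 d1 l1]]] := greedy_phase symA regA d2.
have /(@gamma_t_le_undominated0 _ _ _) : #|undominated adj T1| = 0 by lia.
by have := max_card T1; rewrite cards0 in c5; lia.
Qed.

(** * Comparison of the cover with its base *)

Local Open Scope ring_scope.

Theorem theorem2p12 (VF VG : finType) (adjF : rel VF) (adjG : rel VG)
    (pi : VG -> VF) (k : nat) :
  simple_graph adjF -> simple_graph adjG ->
  k_fold_cover adjG adjF pi k ->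
  (regular adjF 3 ->
     (3%:R / 5%:R) * k%:R * (gamma_t adjF)%:R <= (gamma_t adjG)%:R :> rat) /\
  (regular adjF 4 \/ regular adjF 5 ->
     (1%:R / 2%:R) * k%:R * (gamma_t adjF)%:R <= (gamma_t adjG)%:R :> rat).
Proof.
move=> [symF _] [symG _] cov; have cardG := card_k_fold_cover cov.
have lower r : regular adjF r -> (0 < r -> k * #|VF| <= r * gamma_t adjG)%N.
  move=> regF; rewrite -cardG; apply: gamma_t_ge_regular => //.
  exact: regular_cover cov.1 regF.
split=> [reg3|[reg4|reg5]].
(* Here [9 * k * gamma_t adjF <= 5 * k * #|VF| <= 15 * gamma_t adjG]. *)
- have le : (3 * (k * gamma_t adjF) <= 5 * gamma_t adjG)%N.
    by have := lower _ reg3 isT; have := gamma_t_3regular symF reg3; nia.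
  by move: le; rewrite -(ler_nat rat) !natrM; lra.
- have le : (k * gamma_t adjF <= 2 * gamma_t adjG)%N.
    by have := lower _ reg4 isT; have := gamma_t_4regular symF reg4; nia.
  by move: le; rewrite -(ler_nat rat) !natrM; lra.
have le : (k * gamma_t adjF <= 2 * gamma_t adjG)%N.
  by have := lower _ reg5 isT; have := gamma_t_5regular symF reg5; nia.
by move: le; rewrite -(ler_nat rat) !natrM; lra.
Qed.
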